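(* Let $(X,d)$ be a complete $b$-rectangular metric space with coefficient $s>1$ and let $T:X\to X$ be a $(\phi,F)$-contraction of type $(\mathbb{F})$, i.e. there exist functions $F:(0,+\infty)\to\mathbb{R}$ and $\phi:(0,+\infty)\to(0,+\infty)$ satisfying conditions (i)--(v) listed in the context (with this $s$) such that for all $x,y\in X$, $$d(Tx,Ty)>0\ \Longrightarrow\ F\big(s\,d(Tx,Ty)\big)+\phi\big(d(x,y)\big)\le F\big(d(x,y)\big).$$ Then $T$ has a unique fixed point.
   Context: A $b$-rectangular metric space with coefficient $s\ge 1$ is a nonempty set $X$ with a map $d:X\times X\to[0,+\infty)$ such that for all $x,y\in X$ and all distinct points $u,v\in X$, each distinct from $x$ and $y$: (1) $d(x,y)=0$ if and only if $x=y$; (2) $d(x,y)=d(y,x)$; (3) $d(x,y)\le s[d(x,u)+d(u,v)+d(v,y)]$. A sequence $(x_n)$ converges to $x$ if $d(x_n,x)\to 0$; it is Cauchy if $d(x_n,x_m)\to 0$ as $n,m\to\infty$; the space is complete if every Cauchy sequence converges to some point of $X$. Conditions on the pair $(F,\phi)$, relative to the coefficient $s$: (i) $F$ is strictly increasing; (ii) for each sequence $(x_n)$ of positive numbers, $\lim_{n\to\infty}x_n=0$ if and only if $\lim_{n\to\infty}F(x_n)=-\infty$; (iii) $\liminf_{u\to\alpha^+}\phi(u)>0$ for all $\alpha>0$; (iv) there exists $k\in(0,1)$ such that $\lim_{x\to0^+}x^kF(x)=0$; (v) for each sequence $(\alpha_n)_{n\ge1}$ of positive numbers such that $\phi(\alpha_n)+F(s\alpha_{n+1})\le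 F(\alpha_n)$ for all $n\ge1$, one has $\phi(\alpha_n)+F(s^n\alpha_{n+1})\le F(s^{n-1}\alpha_n)$ for all $n\ge1$. *)

(* Defs.v *)
From HB Require Import structures.
From mathcomp Require Import all_boot all_order all_algebra.
From mathcomp Require Import all_classical all_reals all_analysis.

Set Implicit Arguments.
Unset Strict Implicit.
Unset Printing Implicit Defensive.

Import Order.TTheory GRing.Theory Num.Theory.
Import numFieldNormedType.Exports.

Local Open Scope classical_set_scope.
Local Open Scope ring_scope.

Section BRectangular.
Context {R : realType} {X : Type}.
Implicit Types (d : X -> X -> R) (s : R).

Record b_rectangular_metric d s : Prop := BRectangularMetric {
  brm_nonempty : inhabited X;
  brm_coef_ge1 : 1 <= s;
  brm_ge0 : forall x y, 0 <= d x y;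
  brm_eq0 : forall x y, d x y = 0 <-> x = y;
  brm_sym : forall x y, d x y = d y x;
  brm_rectangle : forall x y u v,
    u <> v -> u <> x -> u <> y -> v <> x -> v <> y ->
    d x y <= s * (d x u + d u v + d v y)
}.

(* A b-rectangular metric need not be continuous nor its balls open, so
   convergence is stated through the real numbers d (x_ n) l only. *)
Definition brm_converges d (x_ : nat -> X) (l : X) : Prop :=
  d (x_ n) l @[n --> \oo] --> (0 : R).

Definition brm_cauchy d (x_ : nat -> X) : Prop :=
  d (x_ nm.1) (x_ nm.2) @[nm --> (\oo, \oo)] --> (0 : R).

Definition brm_complete d : Prop :=
  forall x_ : nat -> X, brm_cauchy d x_ -> exists l, brm_converges d x_ l.

End BRectangular.

(* Functions on (0, +oo) are represented by total functions R -> R; every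
   condition below only involves their values at positive arguments. *)
Record contraction_pair {R : realType} (s : R) (F phi : R -> R) : Prop :=
  ContractionPair {
  cp_phi_gt0 : forall t : R, 0 < t -> 0 < phi t;
  cp_increasing : {in Num.pos &, {homo F : t u / t < u}};
  cp_cvg_ninfty : forall x_ : nat -> R, (forall n, 0 < x_ n) ->
    (x_ n @[n --> \oo] --> (0 : R)) <-> (F (x_ n) @[n --> \oo] --> -oo);
  cp_liminf_gt0 : forall a : R, 0 < a ->
    (0 < limf_einf (fun u => (phi u)%:E) a^'+)%E;
  cp_power : exists k : R,
    [/\ 0 < k, k < 1 & t `^ k * F t @[t --> 0^'+] --> (0 : R)];
  cp_iterate : forall a_ : nat -> R, (forall n, (1 <= n)%N -> 0 < a_ n) ->
    (forall n, (1 <= n)%N -> phi (a_ n) + F (s * a_ n.+1) <= F (a_ n)) ->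
    forall n, (1 <= n)%N ->
      phi (a_ n) + F (s ^+ n * a_ n.+1) <= F (s ^+ n.-1 * a_ n)
}.

Definition phiF_contraction {R : realType} {X : Type}
    (d : X -> X -> R) (s : R) (T : X -> X) : Prop :=
  exists F phi : R -> R, contraction_pair s F phi /\
    forall x y, 0 < d (T x) (T y) ->
      F (s * d (T x) (T y)) + phi (d x y) <= F (d x y).

(* Main.v *)
Require Import Defs.
From mathcomp Require Import all_boot all_order all_algebra.
From mathcomp Require Import all_classical all_reals all_analysis.
From mathcomp Require Import lra.
Import Order.TTheory GRing.Theory Num.Theory.
Import numFieldNormedType.Exports.
Local Open Scope classical_set_scope.
Local Open Scope ring_scope.

(** Since [phi > 0] and [F] is increasing, the contraction condition already
    gives [s d(Tx, Ty) <= d(x, y)], so [T] is a Banach contraction with ratio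
    [1/s]. Applying the rectangle inequality through [x_(n+2)] and [x_(m+2)]
    along an orbit gives
      [d(x_n, x_m) <= s (s^-n + s^-m) d(x_0, x_2) + s^-1 d(x_n, x_m)],
    and [s^-1 < 1] lets one absorb the last term: the orbit is Cauchy. *)

Lemma phiF_contraction_lipschitz (R : realType) (X : Type) (d : X -> X -> R)
    (s : R) (T : X -> X) : b_rectangular_metric d s -> phiF_contraction d s T ->
  forall x y, s * d (T x) (T y) <= d x y.
Proof.
move=> hd [F [phi [hF hT]]] x y.
have s0 : 0 < s by apply: lt_le_trans (brm_coef_ge1 hd).
have [dT0|dT0] := leP (d (T x) (T y)) 0.
  apply: le_trans (brm_ge0 hd x y); rewrite mulr_ge0_le0 //; exact: ltW.
(* [F] and [phi] are constrained only at positive arguments, so positivity of [d x y] must come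
   before any use of monotonicity. *)
have dxy0 : 0 < d x y.
  rewrite lt_neqAle (brm_ge0 hd) andbT eq_sym; apply/eqP => /(brm_eq0 hd) xy.
  by move: dT0; rewrite xy (brm_eq0 hd (T y) (T y)).2 ?ltxx.
rewrite leNgt; apply/negP => lt_d.
have lt_F : F (d x y) < F (s * d (T x) (T y)).
  by apply: (cp_increasing hF); rewrite ?posrE ?mulr_gt0.
have := hT x y dT0; have := cp_phi_gt0 hF dxy0; lra.
Qed.

Section BanachContraction.
Context (R : realType) (X : Type) (d : X -> X -> R) (s : R) (T : X -> X).
Hypotheses (hd : b_rectangular_metric d s) (hs : 1 < s).
Hypothesis hT : forall x y, s * d (T x) (T y) <= d x y.

Let s_gt0 : 0 < s. Proof. exact: lt_trans hs. Qed.

Lemma brm_xx x : d x x = 0. Proof. exact: (brm_eq0 hd x x).2. Qed.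

Lemma contraction_iter n x y : d (iter n T x) (iter n T y) <= s ^- n * d x y.
Proof.
rewrite ler_pdivlMl ?exprn_gt0 //; elim: n => [|n IHn]; first by rewrite mul1r.
apply: le_trans IHn; rewrite exprSr -mulrA !iterS.
by rewrite ler_wpM2l ?exprn_ge0 ?hT // ltW.
Qed.

(** The contraction turns the hypothesis into [(s - 1) * d x y <= 0]. This serves both for
    injectivity of orbits and for uniqueness of the fixed point. *)
Lemma contraction_eq x y : d x y <= d (T x) (T y) -> x = y.
Proof.
move=> le_d; apply/(brm_eq0 hd)/eqP; rewrite eq_le (brm_ge0 hd) andbT.
have le_s : s * d x y <= d x y.
  by apply: le_trans (hT x y); rewrite ler_wpM2l // ltW.
rewrite -(pmulr_rle0 (x := s - 1)) ?subr_gt0 //; lra.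
Qed.

Lemma iter_inj_of_no_fixpoint x :
  (forall n, iter n.+1 T x <> iter n T x) -> injective (fun n => iter n T x).
Proof.
move=> nfix.
suff lt_neq n m : (n < m)%N -> iter n T x <> iter m T x.
  by move=> n m /= nm; have [/lt_neq|/lt_neq/(_ (esym nm))|] := ltngtP n m.
move=> lt_nm nm; apply: (nfix n); apply/esym/contraction_eq.
have -> : d (iter n T x) (iter n.+1 T x) = d (iter m T x) (iter m.+1 T x).
  by rewrite !iterS nm.
(* Writing [m] as [(m - n.+1) + n.+1] presents the step at [m] as an iterated image of the step at
   [n.+1], hence no longer than it. *)
rewrite -(subnK lt_nm) -(addnS _ n.+1) !iterD.
apply: (le_trans (contraction_iter _ _ _)).
rewrite ler_piMl ?(brm_ge0 hd) // invf_le1 ?exprn_gt0 //.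
by rewrite exprn_ege1 // ltW.
Qed.

(** Shifting both indices by two, not one, makes the middle term of the rectangle at most
    [s * s ^- 2 = s^-1] times the left side. Dividing by [1 - s^-1] yields the constant
    [s ^+ 2 / (s - 1)]. *)
Lemma orbit_dist_le x : injective (fun n => iter n T x) -> forall n m,
  d (iter n T x) (iter m T x) <=
    s ^+ 2 / (s - 1) * d x (iter 2 T x) * (s ^- n + s ^- m).
Proof.
move=> inj.
have sn0 n : 0 <= s ^- n by rewrite invr_ge0 exprn_ge0 // ltW.
set K := d x _; have K0 : 0 <= K := brm_ge0 hd _ _.
have s1 : 0 < s - 1 by rewrite subr_gt0.
have step n : d (iter n T x) (iter n.+2 T x) <= s ^- n * K.
  by rewrite -(addn2 n) iterD; exact: contraction_iter.
have C1 : 1 <= s ^+ 2 / (s - 1) by rewrite ler_pdivlMr // mul1r; nra.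
have near_case n m : s ^- n * K <= s ^+ 2 / (s - 1) * K * (s ^- n + s ^- m).
  rewrite mulrC; apply: ler_pM => //; last by rewrite lerDl.
  by rewrite ler_peMl.
move=> n m.
(* The rectangle degenerates when [n = m], [m = n.+2] or [n = m.+2]; these pairs are bounded
   directly. *)
have [->|nm] := eqVneq n m.
  by rewrite brm_xx !mulr_ge0 ?addr_ge0 ?invr_ge0 ?exprn_ge0 // ltW.
have [->|nm2] := eqVneq m n.+2; first exact: (le_trans (step _) (near_case _ _)).
have [->|mn2] := eqVneq n m.+2.
  by rewrite (brm_sym hd) (addrC (s ^- _)); exact: (le_trans (step _) (near_case _ _)).
have neq i j : i != j -> iter i T x <> iter j T x.
  by move=> /eqP ij /inj.
have neqSS i : i.+2 != i by rewrite gtn_eqF.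
have le_rect : d (iter n T x) (iter m T x) <= s * (d (iter n T x) (iter n.+2 T x)
    + d (iter n.+2 T x) (iter m.+2 T x) + d (iter m.+2 T x) (iter m T x)).
  by apply: (brm_rectangle hd); apply: neq; rewrite ?eqSS // eq_sym.
have hn := step n; have hm := step m; rewrite (brm_sym hd) in hm.
have hnm := contraction_iter 2 (iter n T x) (iter m T x).
rewrite -!iterD !add2n ler_pdivlMl ?exprn_gt0 // in hnm.
rewrite -[leRHS]mulrA [leRHS]mulrAC ler_pdivlMr //.
(* The extra factor [s] gives the middle term the coefficient [s ^+ 2], which is exactly what [hnm]
   bounds by the distance to be absorbed. *)
have le_sum : s * d (iter n T x) (iter m T x) <= s * (s * (s ^- n * K
    + d (iter n.+2 T x) (iter m.+2 T x) + s ^- m * K)).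
  by rewrite ler_pM2l //; apply: (le_trans le_rect); rewrite ler_pM2l //; lra.
nra.
Qed.

Lemma cvg_expr_inv : s ^- n @[n --> \oo] --> (0 : R).
Proof.
under eq_fun do rewrite -exprVn.
by apply: cvg_expr; rewrite ger0_norm ?invr_ge0 ?invf_lt1 // ltW.
Qed.

Lemma orbit_cauchy x : injective (fun n => iter n T x) ->
  brm_cauchy d (fun n => iter n T x).
Proof.
move=> inj; set C := s ^+ 2 / (s - 1) * d x (iter 2 T x).
apply: (@squeeze_cvgr _ _ _ _ (fun=> 0)
  (fun nm : nat * nat => C * (s ^- nm.1 + s ^- nm.2))).
- by apply: nearW => nm /=; rewrite (brm_ge0 hd) orbit_dist_le.
- exact: cvg_cst.
- rewrite -[X in _ --> X](mulr0 C) -[X in C * X](addr0 0).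
  apply: cvgMl_tmp; apply: cvgD.
    exact: cvg_comp cvg_fst cvg_expr_inv.
  exact: cvg_comp cvg_snd cvg_expr_inv.
Qed.

(** Such a sequence meets [p] at most once. This provides the distinctness conditions of the
    rectangle inequality near a limit. *)
Lemma injective_eventually_neq (u : nat -> X) (p : X) :
  injective u -> \forall n \near \oo, u n <> p.
Proof.
move=> inj; have [[n0 <-]|np] := pselect (exists n, u n = p).
  by exists n0.+1 => // n /= lt_n /inj eq_n; rewrite eq_n ltnn in lt_n.
by apply: nearW => n un; apply: np; exists n.
Qed.

Lemma orbit_limit_fixed x l : injective (fun n => iter n T x) ->
  brm_converges d (fun n => iter n T x) l -> T l = l.
Proof.
move=> inj cvg_l; apply/esym/(brm_eq0 hd)/eqP; rewrite eq_le (brm_ge0 hd) andbT.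
have cvg_step : d (iter n T x) (iter n.+1 T x) @[n --> \oo] --> (0 : R).
  apply: (@squeeze_cvgr _ _ _ _ (fun=> 0) (fun n => s ^- n * d x (T x))).
  - apply: nearW => n /=; rewrite (brm_ge0 hd).
    by rewrite -iterS iterSr contraction_iter.
  - exact: cvg_cst.
  - rewrite -[X in _ --> X](mul0r (d x (T x))); exact: cvgMr_tmp cvg_expr_inv.
(* The second [d (iter n T x) l] stands for the side from [iter n.+1 T x] to [T l], which it
   dominates. *)
have cvg_sum : s * (d (iter n T x) l + d (iter n T x) (iter n.+1 T x)
    + d (iter n T x) l) @[n --> \oo] --> (0 : R).
  rewrite -[X in _ --> X](mulr0 s) -[X in s * X](addr0 0) -[X in X + _](addr0 0).
  by apply: cvgMl_tmp; apply: cvgD => //; apply: cvgD.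
apply: (@ler_cvg_to _ _ _ _ _ _ _ _ (cvg_cst (d l (T l))) cvg_sum).
have injS : injective (fun n => iter n.+1 T x) by move=> i j /inj [].
near=> n.
have le_lip : d (iter n.+1 T x) (T l) <= d (iter n T x) l.
  apply: le_trans (hT _ _); rewrite iterS ler_peMl ?(brm_ge0 hd) //; exact: ltW.
apply: le_trans (_ : _ <= s * (d l (iter n T x)
    + d (iter n T x) (iter n.+1 T x) + d (iter n.+1 T x) (T l))) _.
  apply: (brm_rectangle hd).
  - by move=> /inj/eqP; rewrite ltn_eqF.
  - near: n; exact: injective_eventually_neq.
  - near: n; exact: injective_eventually_neq.
  - near: n; exact: (injective_eventually_neq _ l injS).
  - near: n; exact: (injective_eventually_neq _ (T l) injS).
by rewrite ler_pM2l // (brm_sym hd l) lerD2l.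
Unshelve. all: by end_near. Qed.

End BanachContraction.

Theorem theorem3p2 (R : realType) (X : Type) (d : X -> X -> R) (s : R)
    (hd : b_rectangular_metric d s) (hs : 1 < s) (hc : brm_complete d)
    (T : X -> X) (hT : phiF_contraction d s T) :
  exists! x : X, T x = x.
Proof.
have hlip := phiF_contraction_lipschitz _ _ _ _ _ hd hT.
have [x0] := brm_nonempty hd.
have [z Tz] : exists z, T z = z.
  (* Either the orbit reaches a fixed point, or it never repeats and the rectangle estimates
     apply. *)
  have [[n Tn]|nfix] := pselect (exists n, iter n.+1 T x0 = iter n T x0).
    by exists (iter n T x0).
  have inj : injective (fun n => iter n T x0).
    apply: (iter_inj_of_no_fixpoint _ _ _ _ _ hd hs hlip) => n Tn.
    by apply: nfix; exists n.
  have [l cvg_l] := hc _ (orbit_cauchy _ _ _ _ _ hd hs hlip _ inj).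
  by exists l; exact: (orbit_limit_fixed _ _ _ _ _ hd hs hlip _ _ inj cvg_l).
exists z; split=> // y Ty.
by apply: (contraction_eq _ _ _ _ _ hd hs hlip); rewrite Tz Ty.
Qed.
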